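(* Let $g\in\mathscr{L}$, let $\mathbb{A}=(A_1,\ldots,A_n)$ be an $n$-tuple of positive definite matrices in $\mathcal{M}_{k_1}$ with $mI\le A_i\le MI$ $(i=1,\ldots,n)$ for some scalars $0<m<M$, and let $w=(w_1,\ldots,w_n)$ be a weight vector. If $\Phi:\mathcal{M}_{k_1}\to\mathcal{M}_{k_2}$ is a unital positive linear map, then for any $p\ge2$, $$\Phi\left(\sum_{i=1}^{n}w_i\,M^{\frac{m^{-1}I-A_i^{-1}}{m^{-1}-M^{-1}}}\,m^{\frac{A_i^{-1}-M^{-1}I}{m^{-1}-M^{-1}}}\right)^p\le \left(\frac{(m+M)^2}{4^{\frac{2}{p}}Mm}\right)^p\Phi\left(\sigma_g(w;\mathbb{A})\right)^p,$$ and $$\Phi\left(\sigma_g(w;\mathbb{A})\right)^p\le \left(\frac{(m+M)^2}{4^{\frac{2}{p}}Mm}\right)^p\Phi\left(\sum_{i=1}^{n}w_i\,M^{\frac{m^{-1}I-A_i^{-1}}{m^{-1}-M^{-1}}}\,m^{\frac{A_i^{-1}-M^{-1}I}{m^{-1}-M^{-1}}}\right)^p.$$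
   Context: $\mathcal{M}_k$ is the algebra of complex $k\times k$ matrices, $I$ the identity matrix, and $A\le B$ for Hermitian matrices means $B-A$ is positive semidefinite. A weight vector is $w=(w_1,\ldots,w_n)$ with all $w_i>0$ and $\sum_{i=1}^n w_i=1$. $\mathscr{L}$ is the set of all operator monotone functions $g$ on $(0,\infty)$ (real-valued functions, applied to positive definite matrices by functional calculus, with $A\le B\Rightarrow g(A)\le g(B)$ for positive definite matrices of every size) satisfying $g(1)=0$ and $g'(1)=1$. For $g\in\mathscr{L}$, a weight vector $w$ and positive definite $\mathbb{A}=(A_1,\ldots,A_n)$, $\sigma_g(w;\mathbb{A})$ denotes the (unique) positive definite solution $X$ of the generalized Karcher equation $\sum_{i=1}^{n}w_i\,g\left(X^{-1/2}A_iX^{-1/2}\right)=0$. A linear map $\Phi:\mathcal{M}_{k_1}\to\mathcal{M}_{k_2}$ is positive if $A\ge 0$ implies $\Phi(A)\ge0$, and unital if $\Phi(I_{k_1})=I_{k_2}$. The notation $\Phi(B)^p$ means $(\Phi(B))^p$. For a scalar $c>0$ and Hermitian $H$, $c^{H}=\exp((\log c)H)$; thus $M^{\frac{m^{-1}I-A_i^{-1}}{m^{-1}-M^{-1}}}m^{\frac{A_i^{-1}-M^{-1}I}{m^{-1}-M^{-1}}}$ is the function $t\mapsto M^{\frac{m^{-1}-t^{-1}}{m^{-1}-M^{-1}}}m^{\frac{t^{-1}-M^{-1}}{m^{-1}-M^{-1}}}$ applied to $A_i$. *)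

(* Defs.v *)
From HB Require Import structures.
From mathcomp Require Import all_boot all_order all_algebra.
From mathcomp Require Import all_classical all_reals all_analysis.
From mathcomp Require Import complex.

Set Implicit Arguments.
Unset Strict Implicit.
Unset Printing Implicit Defensive.

Import Order.TTheory GRing.Theory Num.Theory.
Import numFieldNormedType.Exports.

Local Open Scope ring_scope.
Local Open Scope complex_scope.
Local Open Scope sesquilinear_scope.

Section Matrices.
Context {R : realType}.
Local Notation C := R[i].

(* On [C], [0 <= z] means that [z] is real and nonnegative. *)
Definition psdmx k (A : 'M[C]_k) : Prop :=
  A \is hermsymmx /\ forall v : 'cV[C]_k, 0 <= (v ^t* *m A *m v) 0 0.

Definition posdefmx k (A : 'M[C]_k) : Prop :=
  A \is hermsymmx /\
  forall v : 'cV[C]_k, v != 0 -> 0 < (v ^t* *m A *m v) 0 0.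

Definition loewner_le k (A B : 'M[C]_k) : Prop := psdmx (B - A).

(* [A = invmx P *m diag_mx (spectral_diag A) *m P] with [P = spectralmx A]
   unitary holds for normal [A]; the result is only meaningful when [A] is
   Hermitian, its eigenvalues then being real. *)
Definition mxfun (f : R -> R) k (A : 'M[C]_k) : 'M[C]_k :=
  invmx (spectralmx A)
    *m diag_mx (map_mx (fun z : C => (f (complex.Re z))%:C) (spectral_diag A))
    *m spectralmx A.

(* Meant for positive semidefinite [A] if [0 < p], positive definite [A]
   otherwise. *)
Definition powmx (p : R) k (A : 'M[C]_k) : 'M[C]_k :=
  mxfun (fun t => t `^ p) A.

Definition cpowmx (c : R) k (H : 'M[C]_k) : 'M[C]_k :=
  mxfun expR ((ln c)%:C *: H).

(* Only the values of [g] on positive reals matter: those are the eigenvalues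
   of positive definite matrices. *)
Definition operator_monotone (g : R -> R) : Prop :=
  forall k (A B : 'M[C]_k), posdefmx A -> posdefmx B ->
    loewner_le A B -> loewner_le (mxfun g A) (mxfun g B).

Definition classL (g : R -> R) : Prop :=
  [/\ operator_monotone g, g 1 = 0 & is_derive (1 : R) (1 : R) g 1].

Definition weight_vector n (w : 'I_n -> R) : Prop :=
  (forall i, 0 < w i) /\ \sum_(i < n) w i = 1.

(* [is_sigma g w A X] : [X] is the mean sigma_g(w; A), that is, the positive
   definite solution of the generalized Karcher equation (there is exactly one
   when [g] is in [classL], [w] is a weight vector and the [A i] are positive
   definite). *)
Definition is_sigma (g : R -> R) n (w : 'I_n -> R) k (A : 'I_n -> 'M[C]_k)
    (X : 'M[C]_k) : Prop :=
  posdefmx X /\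
  \sum_(i < n) (w i)%:C *:
    mxfun g (powmx (- 2^-1) X *m A i *m powmx (- 2^-1) X) = 0.

Definition positive_map k1 k2 (Phi : 'M[C]_k1 -> 'M[C]_k2) : Prop :=
  forall A, psdmx A -> psdmx (Phi A).

Definition unital_map k1 k2 (Phi : 'M[C]_k1 -> 'M[C]_k2) : Prop :=
  Phi 1%:M = 1%:M.

Definition interp_term (m M : R) k (A : 'M[C]_k) : 'M[C]_k :=
  cpowmx M (((m^-1 - M^-1)^-1)%:C *: ((m^-1)%:C%:M - invmx A))
    *m cpowmx m (((m^-1 - M^-1)^-1)%:C *: (invmx A - (M^-1)%:C%:M)).

Definition interp_sum (m M : R) n (w : 'I_n -> R) k (A : 'I_n -> 'M[C]_k) :
    'M[C]_k :=
  \sum_(i < n) (w i)%:C *: interp_term m M (A i).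

End Matrices.

(* Main.v *)
(** The functions [h t = M `^ l * m `^ (1 - l)], where
[l = (m^-1 - t^-1) / (m^-1 - M^-1)], [m * M / h t] and [t] are convex in [1 / t],
so comparison with their chords gives [h t + m * M / t <= m + M] and
[t + m * M / h t <= m + M] on [[m, M]]. Moreover every [g] in the class L
satisfies [1 - 1 / t <= g t <= t - 1], hence [sigma] lies between the weighted
harmonic and arithmetic means. With Choi's inequality
[Phi (X)^-1 <= Phi (X^-1)] and operator convexity of the inverse this yields
[F + m * M * G^-1 <= m + M] and [G + m * M * F^-1 <= m + M] for
[F = Phi (interp_sum)] and [G = Phi (sigma)].

If [X, Y >= 0] and [X + Y <= c] then [X^r + Y^r <= c^r] for [r >= 1], because
[X^r <= c^(r-1) X]; and [|X Y| <= c^2 / 4]. Applied with [r = p / 2] to [F] and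
[m * M * G^-1] this bounds the norm of [F^r G^-r], which is the claim. *)

Require Import Defs.
From HB Require Import structures.
From mathcomp Require Import all_boot all_order all_algebra.
From mathcomp Require Import all_classical all_reals all_analysis.
From mathcomp Require Import complex ring lra.

Set Implicit Arguments.
Unset Strict Implicit.
Unset Printing Implicit Defensive.

Import Order.TTheory GRing.Theory Num.Theory.
Import numFieldNormedType.Exports.

Local Open Scope ring_scope.
Local Open Scope complex_scope.
Local Open Scope sesquilinear_scope.

(** * Quadratic forms and the Loewner order *)

Section Forms.
Context {R : realType}.
Local Notation C := R[i].

Lemma adjmxM m n q (A : 'M[C]_(m, n)) (B : 'M[C]_(n, q)) :
  (A *m B) ^t* = B ^t* *m A ^t*.
Proof. by rewrite trmx_mul map_mxM. Qed.

Lemma adjmxD m n (A B : 'M[C]_(m, n)) : (A + B) ^t* = A ^t* + B ^t*.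
Proof. by rewrite linearD /= map_mxD. Qed.

Lemma adjmxN m n (A : 'M[C]_(m, n)) : (- A) ^t* = - A ^t*.
Proof. by rewrite linearN /= map_mxN. Qed.

Lemma conjC_realc (a : R) : Num.conj (a%:C : C) = a%:C.
Proof. exact: conjc_real. Qed.

Lemma adjmxZ m n (a : R) (A : 'M[C]_(m, n)) : (a%:C *: A) ^t* = a%:C *: A ^t*.
Proof. by rewrite linearZ /= map_mxZ /= conjC_realc. Qed.

Lemma adjmx1 n : (1%:M : 'M[C]_n) ^t* = 1%:M.
Proof. by rewrite trmx1 map_mx1. Qed.

Lemma hermP n (A : 'M[C]_n) : reflect (A ^t* = A) (A \is hermsymmx).
Proof.
apply: (iffP (is_hermitianmxP _ _ _)); rewrite expr0 scale1r => h; exact: esym.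
Qed.

Definition sform m n (A : 'M[C]_(m, n)) (u : 'cV_m) (v : 'cV_n) : C :=
  (u ^t* *m A *m v) 0 0.

Definition dot n (u v : 'cV[C]_n) : C := (u ^t* *m v) 0 0.

Lemma sformE m n (A : 'M[C]_(m, n)) u v : sform A u v = dot u (A *m v).
Proof. by rewrite /sform /dot mulmxA. Qed.

Lemma dot0r n (u : 'cV[C]_n) : dot u 0 = 0.
Proof. by rewrite /dot mulmx0 mxE. Qed.

Lemma dotDl n (u u' v : 'cV[C]_n) : dot (u + u') v = dot u v + dot u' v.
Proof. by rewrite /dot adjmxD mulmxDl mxE. Qed.
Lemma dotDr n (u v v' : 'cV[C]_n) : dot u (v + v') = dot u v + dot u v'.
Proof. by rewrite /dot mulmxDr mxE. Qed.
Lemma dotNl n (u v : 'cV[C]_n) : dot (- u) v = - dot u v.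
Proof. by rewrite /dot adjmxN mulNmx mxE. Qed.
Lemma dotNr n (u v : 'cV[C]_n) : dot u (- v) = - dot u v.
Proof. by rewrite /dot mulmxN mxE. Qed.
Lemma dotZl n (a : R) (u v : 'cV[C]_n) : dot (a%:C *: u) v = a%:C * dot u v.
Proof. by rewrite /dot adjmxZ -scalemxAl mxE. Qed.
Lemma dotZr n (a : C) (u v : 'cV[C]_n) : dot u (a *: v) = a * dot u v.
Proof. by rewrite /dot -scalemxAr mxE. Qed.

Lemma dot_adj m n (A : 'M[C]_(m, n)) u v : dot u (A *m v) = dot (A ^t* *m u) v.
Proof. by rewrite /dot adjmxM trmxCK mulmxA. Qed.

Lemma dot_herm n (A : 'M[C]_n) u v : A \is hermsymmx ->
  dot u (A *m v) = dot (A *m u) v.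
Proof. by move=> /hermP hA; rewrite dot_adj hA. Qed.

Lemma dot_sum n (u v : 'cV[C]_n) : dot u v = \sum_i Num.conj (u i 0) * v i 0.
Proof. by rewrite /dot mxE; apply: eq_bigr => i _; rewrite !mxE. Qed.

Lemma dotxx n (u : 'cV[C]_n) : dot u u = \sum_i `|u i 0| ^+ 2.
Proof. by rewrite dot_sum; apply: eq_bigr => i _; rewrite normCK mulrC. Qed.

Lemma dot_ge0 n (u : 'cV[C]_n) : 0 <= dot u u.
Proof. by rewrite dotxx sumr_ge0// => i _; rewrite exprn_ge0. Qed.

Lemma dot_eq0 n (u : 'cV[C]_n) : (dot u u == 0) = (u == 0).
Proof.
apply/idP/eqP => [|->]; last by rewrite /dot mulmx0 mxE.
rewrite dotxx psumr_eq0 => [/allP h|i _]; last by rewrite exprn_ge0.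
apply/matrixP => i j; rewrite ord1 mxE.
by have := h i (mem_index_enum _); rewrite expf_eq0 /= normr_eq0 => /eqP.
Qed.

Lemma hermD n (A B : 'M[C]_n) :
  A \is hermsymmx -> B \is hermsymmx -> A + B \is hermsymmx.
Proof. by move=> /hermP hA /hermP hB; apply/hermP; rewrite adjmxD hA hB. Qed.
Lemma hermN n (A : 'M[C]_n) : A \is hermsymmx -> - A \is hermsymmx.
Proof. by move=> /hermP hA; apply/hermP; rewrite adjmxN hA. Qed.
Lemma hermB n (A B : 'M[C]_n) :
  A \is hermsymmx -> B \is hermsymmx -> A - B \is hermsymmx.
Proof. by move=> hA /hermN; apply: hermD. Qed.
Lemma hermZ n (a : R) (A : 'M[C]_n) :
  A \is hermsymmx -> a%:C *: A \is hermsymmx.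
Proof. by move=> /hermP hA; apply/hermP; rewrite adjmxZ hA. Qed.
Lemma herm_conj m n (A : 'M[C]_m) (Q : 'M[C]_(m, n)) :
  A \is hermsymmx -> Q ^t* *m A *m Q \is hermsymmx.
Proof. by move=> /hermP hA; apply/hermP; rewrite !adjmxM trmxCK hA mulmxA. Qed.

Lemma psd_dot n (A : 'M[C]_n) v : psdmx A -> 0 <= dot v (A *m v).
Proof. by case=> _ /(_ v); rewrite -sformE. Qed.

Lemma psdmxP n (A : 'M[C]_n) : A \is hermsymmx ->
  (forall v, 0 <= dot v (A *m v)) -> psdmx A.
Proof. by move=> hA h; split=> // v; have := h v; rewrite -sformE. Qed.

Lemma posdef_dot n (A : 'M[C]_n) v : posdefmx A -> v != 0 ->
  0 < dot v (A *m v).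
Proof. by case=> _ h /h; rewrite -sformE. Qed.

Lemma posdefmxP n (A : 'M[C]_n) : A \is hermsymmx ->
  (forall v, v != 0 -> 0 < dot v (A *m v)) -> posdefmx A.
Proof. by move=> hA h; split=> // v /h; rewrite -sformE. Qed.

Lemma posdef_psd n (A : 'M[C]_n) : posdefmx A -> psdmx A.
Proof.
move=> pA; apply: psdmxP => [|v]; first by case: pA.
have [->|v0] := eqVneq v 0; first by rewrite mulmx0 /dot mulmx0 mxE.
exact/ltW/posdef_dot.
Qed.

Lemma psdD n (A B : 'M[C]_n) : psdmx A -> psdmx B -> psdmx (A + B).
Proof.
move=> pA pB; apply: psdmxP => [|v]; first by case: pA => ? _; case: pB => ? _; exact: hermD.
by rewrite mulmxDl dotDr addr_ge0// psd_dot.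
Qed.

Lemma psdZ n (a : R) (A : 'M[C]_n) : 0 <= a -> psdmx A -> psdmx (a%:C *: A).
Proof.
move=> a0 pA; apply: psdmxP => [|v]; first by case: pA => ? _; exact: hermZ.
by rewrite -scalemxAl dotZr mulr_ge0// ?psd_dot// ler0c.
Qed.

Lemma psd_conj m n (A : 'M[C]_m) (Q : 'M[C]_(m, n)) :
  psdmx A -> psdmx (Q ^t* *m A *m Q).
Proof.
move=> pA; apply: psdmxP => [|v]; first by case: pA => ? _; exact: herm_conj.
by rewrite -!mulmxA dot_adj trmxCK psd_dot.
Qed.

Lemma psd0 n : psdmx (0 : 'M[C]_n).
Proof.
apply: psdmxP => [|v]; first by apply/hermP; rewrite trmx0 map_mx0.
by rewrite mul0mx dot0r.
Qed.

Lemma psd_sum (I : Type) (r : seq I) n (F : I -> 'M[C]_n) :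
  (forall i, psdmx (F i)) -> psdmx (\sum_(i <- r) F i).
Proof. by move=> h; apply: (@big_ind _ (@psdmx R n) _ _ (@psd0 n) (@psdD n)). Qed.

Lemma loewner_refl n (A : 'M[C]_n) : loewner_le A A.
Proof. by rewrite /loewner_le subrr; exact: psd0. Qed.

Lemma loewner_trans n (A B D : 'M[C]_n) :
  loewner_le A B -> loewner_le B D -> loewner_le A D.
Proof. by move=> h1 h2; have := psdD h2 h1; rewrite /loewner_le addrA subrK. Qed.

Lemma loewnerD n (A B A' B' : 'M[C]_n) :
  loewner_le A B -> loewner_le A' B' -> loewner_le (A + A') (B + B').
Proof. by move=> h1 h2; have := psdD h1 h2; rewrite /loewner_le addrACA opprD. Qed.

Lemma loewnerZ n (a : R) (A B : 'M[C]_n) : 0 <= a ->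
  loewner_le A B -> loewner_le (a%:C *: A) (a%:C *: B).
Proof. by move=> a0 h; have := psdZ a0 h; rewrite /loewner_le scalerBr. Qed.

Lemma loewner_sum (I : Type) (r : seq I) n (F G : I -> 'M[C]_n) :
  (forall i, loewner_le (F i) (G i)) ->
  loewner_le (\sum_(i <- r) F i) (\sum_(i <- r) G i).
Proof. by move=> h; rewrite /loewner_le -sumrB; exact: psd_sum. Qed.

Lemma loewner_conj m n (A B : 'M[C]_m) (Q : 'M[C]_(m, n)) :
  loewner_le A B -> loewner_le (Q ^t* *m A *m Q) (Q ^t* *m B *m Q).
Proof. by move=> /(psd_conj Q); rewrite /loewner_le mulmxBr mulmxBl. Qed.

End Forms.

(** * Functional calculus in a unitary basis *)

Section FunctionalCalculus.
Context {R : realType}.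
Local Notation C := R[i].

(** An arbitrary unitary basis replaces [spectralmx], so that all functions of one matrix share a
    basis and their relations become pointwise ones on [d]. *)
Definition udiag n (P : 'M[C]_n) (d : 'I_n -> R) : 'M[C]_n :=
  P ^t* *m diag_mx (\row_i (d i)%:C) *m P.

Lemma eq_conj_diag n (P : 'M[C]_n) (D E : 'rV[C]_n) : D = E ->
  P ^t* *m diag_mx D *m P = P ^t* *m diag_mx E *m P.
Proof. by move->. Qed.

Lemma herm_udiag n (A : 'M[C]_n) : A \is hermsymmx ->
  exists2 P : 'M[C]_n, P \is unitarymx & exists d, A = udiag P d.
Proof.
move=> hA; exists (spectralmx A); first exact: spectral_unitarymx.
exists (fun i => complex.Re (spectral_diag A 0 i)).
have /orthomx_spectralP {1}-> := hermitian_normalmx hA.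
rewrite (invmx_unitary (spectral_unitarymx A)); apply: eq_conj_diag.
apply/rowP => i; rewrite mxE RRe_real//.
by have /mxOverP := hermitian_spectral_diag_real hA; apply.
Qed.

Section Unitary.
Variables (n : nat) (P : 'M[C]_n).
Hypothesis Pu : P \is unitarymx.

Lemma mul_unitary_adj : P *m P ^t* = 1%:M.
Proof. exact/unitarymxP. Qed.

Lemma mul_adj_unitary : P ^t* *m P = 1%:M.
Proof. exact/mulmx1C/unitarymxP. Qed.

Lemma udiag_herm d : udiag P d \is hermsymmx.
Proof.
apply: herm_conj; apply/hermP; rewrite tr_diag_mx map_diag_mx.
by congr diag_mx; apply/rowP => i; rewrite !mxE; exact: conjC_realc.
Qed.

Lemma eq_udiag d e : d =1 e -> udiag P d = udiag P e.
Proof. by move=> /funext ->. Qed.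

Lemma udiagM d e : udiag P d *m udiag P e = udiag P (fun i => d i * e i).
Proof.
rewrite /udiag -!mulmxA (mulmxA P) mul_unitary_adj mul1mx (mulmxA (diag_mx _)).
rewrite [diag_mx _ *m diag_mx _](_ : _ = diag_mx (\row_i (d i * e i)%:C))//.
by apply/matrixP => i j; rewrite mul_diag_mx !mxE rmorphM mulrnAr.
Qed.

Lemma udiagD d e : udiag P d + udiag P e = udiag P (fun i => d i + e i).
Proof.
rewrite /udiag -mulmxDl -mulmxDr -linearD; apply: eq_conj_diag.
by apply/rowP => i; rewrite !mxE rmorphD.
Qed.

Lemma udiagZ (a : R) d : a%:C *: udiag P d = udiag P (fun i => a * d i).
Proof.
rewrite /udiag scalemxAl scalemxAr -linearZ; apply: eq_conj_diag.
by apply/rowP => i; rewrite !mxE rmorphM.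
Qed.

Lemma udiagN d : - udiag P d = udiag P (fun i => - d i).
Proof.
rewrite /udiag -mulNmx -mulmxN -linearN; apply: eq_conj_diag.
by apply/rowP => i; rewrite !mxE rmorphN.
Qed.

Lemma udiagB d e : udiag P d - udiag P e = udiag P (fun i => d i - e i).
Proof. by rewrite udiagN udiagD. Qed.

Lemma udiag_const (a : R) : udiag P (fun=> a) = (a%:C)%:M.
Proof.
rewrite /udiag (_ : diag_mx _ = (a%:C)%:M).
  by rewrite mul_mx_scalar -scalemxAl mul_adj_unitary scalemx1.
by apply/matrixP => i j; rewrite !mxE.
Qed.

Lemma dot_udiag d v :
  dot v (udiag P d *m v) = \sum_i (d i)%:C * `|(P *m v) i 0| ^+ 2.
Proof.
rewrite /udiag -!mulmxA dot_adj trmxCK dot_sum; apply: eq_bigr => i _.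
rewrite mul_diag_mx; move: (P *m v) => w; rewrite !mxE mulrCA normCK.
by rewrite [X in _ * X = _]mulrC.
Qed.

(** The vector [P ^t* *m delta_mx i 0] is the eigenvector of [udiag P d] for [d i]; testing a form
    on it reads off that entry. *)
Lemma unitary_col i : P *m (P ^t* *m delta_mx i 0) = delta_mx i 0 :> 'cV_n.
Proof. by rewrite mulmxA mul_unitary_adj mul1mx. Qed.

Lemma unitary_col_neq0 i : P ^t* *m delta_mx i 0 != 0 :> 'cV_n.
Proof.
apply/negP => /eqP /(congr1 (mulmx P)); rewrite unitary_col mulmx0.
by move=> /matrixP/(_ i 0)/eqP; rewrite !mxE !eqxx oner_eq0.
Qed.

Lemma udiag_eigen d i :
  udiag P d *m (P ^t* *m delta_mx i 0) = (d i)%:C *: (P ^t* *m delta_mx i 0) :> 'cV_n.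
Proof.
rewrite /udiag -!mulmxA unitary_col scalemxAr; apply: congr1.
apply/matrixP => j k; rewrite ord1 mul_diag_mx !mxE.
by case: eqP => [->|]//=; rewrite ?andbF ?mulr0.
Qed.

Lemma dot_udiag_col d i :
  dot (P ^t* *m delta_mx i 0) (udiag P d *m (P ^t* *m delta_mx i 0)) = (d i)%:C.
Proof.
rewrite dot_udiag unitary_col (bigD1 i)//= big1 => [|j ji].
  by rewrite !mxE !eqxx normr1 expr1n mulr1 addr0.
by rewrite mxE (negbTE ji) normr0 expr0n mulr0.
Qed.

Lemma psd_udiag d : psdmx (udiag P d) <-> forall i, 0 <= d i.
Proof.
split=> [pd i|d0].
  by have := psd_dot (P ^t* *m delta_mx i 0) pd; rewrite dot_udiag_col ler0c.
apply: psdmxP => [|v]; first exact: udiag_herm.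
by rewrite dot_udiag sumr_ge0// => i _; rewrite mulr_ge0 ?exprn_ge0// ler0c.
Qed.

Lemma posdef_udiag d : posdefmx (udiag P d) <-> forall i, 0 < d i.
Proof.
split=> [pd i|d0].
  by have := posdef_dot pd (unitary_col_neq0 i); rewrite dot_udiag_col ltcR.
have pd : psdmx (udiag P d) by apply/psd_udiag => i; exact/ltW.
apply: posdefmxP => [|v v0]; first exact: udiag_herm.
rewrite lt_def psd_dot// andbT; apply: contra v0.
rewrite dot_udiag psumr_eq0 => [/allP h|i _]; last first.
  by rewrite mulr_ge0 ?exprn_ge0// ler0c ltW.
have Pv0 : P *m v = 0.
  apply/matrixP => i j; rewrite ord1 [RHS]mxE.
  have := h i (mem_index_enum _); rewrite mulf_eq0 expf_eq0 /= normr_eq0.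
  by rewrite fmorph_eq0 (gt_eqF (d0 i)) => /eqP.
by apply/eqP; rewrite -[v]mul1mx -mul_adj_unitary -mulmxA Pv0 mulmx0.
Qed.

Lemma loewner_udiag d e :
  loewner_le (udiag P d) (udiag P e) <-> forall i, d i <= e i.
Proof.
rewrite /loewner_le udiagB psd_udiag.
by split=> h i; have := h i; rewrite subr_ge0.
Qed.

Lemma invmx_udiag d : (forall i, d i != 0) ->
  invmx (udiag P d) = udiag P (fun i => (d i)^-1).
Proof.
move=> d0; have h : udiag P (fun i => (d i)^-1) *m udiag P d = 1%:M.
  rewrite udiagM (_ : 1%:M = (1%:C)%:M)// -udiag_const.
  by apply: eq_udiag => i; rewrite mulVf.
have [_ u] := mulmx1_unit h.
by rewrite -[LHS]mul1mx -h mulmxK.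
Qed.

End Unitary.

(* Both diagonalizations are intertwined by [W := Q *m P ^t*], which can only
   have a nonzero entry where the corresponding eigenvalues agree. *)
Lemma udiag_map n (P Q : 'M[C]_n) d e (f : R -> R) :
  P \is unitarymx -> Q \is unitarymx -> udiag P d = udiag Q e ->
  udiag P (f \o d) = udiag Q (f \o e).
Proof.
move=> Pu Qu PQ; pose W := Q *m P ^t*.
have key (a b : 'I_n -> R) : diag_mx (\row_i (b i)%:C) *m W = W *m diag_mx (\row_i (a i)%:C) <->
    udiag P a = udiag Q b.
  rewrite /udiag /W; split=> h.
    have := congr1 (fun X => Q ^t* *m (X *m P)) h.
    rewrite -!mulmxA (mul_adj_unitary Pu) mulmx1 (mulmxA _ Q (_ *m _)) => ->.
    by rewrite (mul_adj_unitary Qu) mul1mx.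
  have := congr1 (fun X => Q *m (X *m P ^t*)) h.
  rewrite -!mulmxA (mul_unitary_adj Pu) mulmx1 (mulmxA _ (Q ^t*) (_ *m _)) => ->.
  by rewrite (mul_unitary_adj Qu) mul1mx.
have /key h := PQ; apply/key; apply/matrixP => i j.
have /matrixP/(_ i j) := h; rewrite !mul_diag_mx !mul_mx_diag !mxE /=.
move: (\sum_k _) => x; have [->|x0] := eqVneq x 0; first by rewrite !mulr0 !mul0r.
by rewrite mulrC => /(mulfI x0) [->]; rewrite mulrC.
Qed.

(** [mxfun] uses the basis picked by [spectralmx]; by [udiag_map] any other diagonalizing unitary
    basis gives the same matrix. *)
Lemma mxfun_udiag n (P : 'M[C]_n) d (f : R -> R) : P \is unitarymx ->
  mxfun f (udiag P d) = udiag P (f \o d).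
Proof.
move=> Pu; have hA := udiag_herm P d; set A := udiag P d in hA *.
have Su := spectral_unitarymx A.
pose e i := complex.Re (spectral_diag A 0 i).
have eE i : (e i)%:C = spectral_diag A 0 i.
  by rewrite RRe_real//; have /mxOverP := hermitian_spectral_diag_real hA; apply.
transitivity (udiag (spectralmx A) (f \o e)).
  rewrite /mxfun (invmx_unitary Su); apply: eq_conj_diag.
  by apply/rowP => i; rewrite !mxE.
apply: udiag_map => //.
have /orthomx_spectralP AE := hermitian_normalmx hA.
rewrite -/A [RHS]AE (invmx_unitary Su); apply: eq_conj_diag.
by apply/rowP => i; rewrite !mxE.
Qed.

Lemma psd_udiagP n (A : 'M[C]_n) : psdmx A ->
  exists2 P : 'M[C]_n, P \is unitarymx &
    exists2 d, A = udiag P d & forall i, 0 <= d i.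
Proof.
move=> pA; have [P Pu [d dE]] := herm_udiag (proj1 pA).
by exists P => //; exists d => //; apply/(psd_udiag Pu); rewrite -dE.
Qed.

Lemma posdef_udiagP n (A : 'M[C]_n) : posdefmx A ->
  exists2 P : 'M[C]_n, P \is unitarymx &
    exists2 d, A = udiag P d & forall i, 0 < d i.
Proof.
move=> pA; have [P Pu [d dE]] := herm_udiag (proj1 pA).
by exists P => //; exists d => //; apply/(posdef_udiag Pu); rewrite -dE.
Qed.

Lemma posdef_unit n (A : 'M[C]_n) : posdefmx A -> A \in unitmx.
Proof.
move=> /posdef_udiagP[P Pu [d -> d0]].
have : udiag P (fun i => (d i)^-1) *m udiag P d = 1%:M.
  rewrite udiagM// (_ : 1%:M = (1%:C)%:M)// -(udiag_const Pu).
  by apply: eq_udiag => i; rewrite mulVf ?gt_eqF.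
by case/mulmx1_unit.
Qed.

Lemma posdef_inv n (A : 'M[C]_n) : posdefmx A -> posdefmx (invmx A).
Proof.
move=> /posdef_udiagP[P Pu [d -> d0]].
rewrite invmx_udiag// => [|i]; last by rewrite gt_eqF.
by apply/(posdef_udiag Pu) => i; rewrite invr_gt0.
Qed.

End FunctionalCalculus.

(** * Norms of products of powers *)

Section NormOfProduct.
Context {R : realType}.
Local Notation C := R[i].

Lemma loewner_dot n (A B : 'M[C]_n) v :
  loewner_le A B -> dot v (A *m v) <= dot v (B *m v).
Proof.
by move=> /(psd_dot v); rewrite mulmxBl dotDr dotNr subr_ge0.
Qed.

Lemma psd_sqr_le n (A : 'M[C]_n) (c : R) :
  psdmx A -> loewner_le A (c%:C)%:M -> loewner_le (A *m A) (c%:C *: A).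
Proof.
move=> /psd_udiagP[P Pu [d -> d0]]; rewrite -(udiag_const Pu c) (udiagM Pu) (udiagZ P).
move=> /(loewner_udiag Pu) dc; apply/(loewner_udiag Pu) => i.
exact: ler_wpM2r.
Qed.

Lemma loewner_addr n (A B D : 'M[C]_n) :
  psdmx A -> loewner_le (A + B) D -> loewner_le B D.
Proof.
by move=> pA /psdD/(_ pA); rewrite /loewner_le opprD addrA addrAC subrK.
Qed.

Lemma dot_sub_herm n (A : 'M[C]_n) (c : R) (u y : 'cV[C]_n) : A \is hermsymmx ->
  dot (c%:C *: u - y) (A *m (c%:C *: u - y)) =
  c%:C ^+ 2 * dot u (A *m u) - c%:C * (dot (A *m u) y + dot y (A *m u)) +
  dot y (A *m y).
Proof.
move=> hA; rewrite mulmxBr -scalemxAr dotDl !dotDr !dotNl !dotNr !dotZl !dotZr.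
by rewrite (dot_herm u y hA); ring.
Qed.

Lemma loewner_addl n (A B D : 'M[C]_n) :
  psdmx B -> loewner_le (A + B) D -> loewner_le A D.
Proof. by move=> pB /psdD/(_ pB); rewrite /loewner_le opprD addrA subrK. Qed.

Lemma mulmx_unsandwich n (Y Z W : 'M[C]_n) : Y *m Z = 1%:M ->
  Z *m (Y *m W *m Y) *m Z = W.
Proof.
by move=> YZ; rewrite -!mulmxA YZ mulmx1 mulmxA (mulmx1C YZ) mul1mx.
Qed.

(* With [a := A u], [b := B v] and [N := <u, a> + <v, b>], positivity of [A + B]
   at [a - b] gives [4 s N <= <(A + B) (a + b), a + b>], and positivity of [A]
   at [c u - (a + b)] and of [B] at [c v - (a + b)] bounds the right-hand
   side by [c ^+ 2 * N]. *)
Lemma singular_value_le n (A B : 'M[C]_n) (c s : R) (u v : 'cV[C]_n) :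
  psdmx A -> psdmx B -> 0 < c -> 0 < s -> loewner_le (A + B) (c%:C)%:M ->
  v != 0 -> A *m (B *m v) = s%:C *: u -> B *m (A *m u) = s%:C *: v ->
  s <= c ^+ 2 / 4.
Proof.
move=> pA pB c0 s0 ABc v0 ABv BAu.
have hA := proj1 pA; have hB := proj1 pB.
set a := A *m u in BAu; set b := B *m v in ABv.
pose N := dot u a + dot v b.
have u0 : 0 <= dot u a by exact: psd_dot.
have w0 : 0 <= dot v b by exact: psd_dot.
have sC0 : s%:C != 0 :> C by rewrite fmorph_eq0 gt_eqF.
have N0 : 0 < N.
  (* If [N = 0] then [<v, B v> = 0], and [B^2 <= c B] forces [B v = 0]; hence [u = 0], and then
     [v = 0]. *)
  rewrite lt_def (addr_ge0 u0 w0) andbT (paddr_eq0 u0 w0).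
  apply: contra v0 => /andP[_ /eqP vb0].
  have b0 : b = 0.
    apply/eqP; rewrite -dot_eq0 eq_le dot_ge0 andbT.
    have := loewner_dot v (psd_sqr_le pB (loewner_addr pA ABc)).
    by rewrite -mulmxA dot_herm// -scalemxAl dotZr -/b vb0 mulr0.
  have : u = 0.
    apply/eqP; move/eqP: ABv.
    by rewrite b0 mulmx0 eq_sym scaler_eq0 (negbTE sC0).
  move=> u00; move/eqP: BAu; rewrite /a u00 !mulmx0 eq_sym scaler_eq0.
  by rewrite (negbTE sC0).
(* [y] is kept opaque, so that the expansions below treat it as one vector. *)
have [y yE] : exists y, y = a + b by exists (a + b).
pose T := dot y ((A + B) *m y).
have TN : T <= c%:C ^+ 2 * N.
  have A1 := psd_dot (c%:C *: u - y) pA.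
  have B1 := psd_dot (c%:C *: v - y) pB.
  have := loewner_dot y ABc; rewrite -/T mul_scalar_mx dotZr => C1.
  rewrite -subr_ge0.
  (* The cross terms add up to [- 2 c <y, y>], which is why [c <y, y> - T], nonnegative by
     [A + B <= c], is counted twice. *)
  have -> : c%:C ^+ 2 * N - T = (dot (c%:C *: u - y) (A *m (c%:C *: u - y)) +
     dot (c%:C *: v - y) (B *m (c%:C *: v - y))) + 2 * (c%:C * dot y y - T).
    rewrite (dot_sub_herm _ _ _ hA) (dot_sub_herm _ _ _ hB) -/a -/b.
    rewrite /T mulmxDl (dotDr y (A *m y)).
    have -> : dot y y = dot y a + dot y b by rewrite -dotDr -yE.
    have yab : dot a y + dot b y = dot y a + dot y b by rewrite -dotDl -dotDr -yE.
    have {yab}-> : dot b y = dot y a + dot y b - dot a y by rewrite -yab addrC addKr.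
    rewrite /N; move: (dot a y) (dot y a) (dot y b) (dot y _) (dot y _) => ? ? ? ? ?.
    by move: (dot u a) (dot v b) => ? ?; ring.
  apply: addr_ge0; first exact: (addr_ge0 A1 B1).
  by rewrite mulr_ge0// subr_ge0.
have sN : 4 * s%:C * N <= T.
  rewrite -subr_ge0.
  have pAB := psd_dot (a - b) (psdD pA pB).
  have -> : T - 4 * s%:C * N = dot (a - b) ((A + B) *m (a - b)); last by [].
  have h1 : dot a ((A + B) *m b) = s%:C * N.
    rewrite mulmxDl dotDr ABv dotZr (dot_herm _ _ hB) BAu dotZl -/b.
    by rewrite -(dot_herm u u hA) -mulrDr.
  have h2 : dot b ((A + B) *m a) = s%:C * N.
    rewrite mulmxDl dotDr BAu dotZr (dot_herm _ _ hA) ABv dotZl -/a.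
    by rewrite -(dot_herm v v hB) -mulrDr.
  rewrite /T yE !(mulmxDr (A + B)) mulmxN !(dotDl, dotDr, dotNl, dotNr) h1 h2.
  by ring.
have := le_trans sN TN; rewrite ler_pM2r// => h.
rewrite ler_pdivlMr// mulrC -lecR rmorphM rmorphXn /=.
by rewrite rmorph_nat.
Qed.

(** This bounds the norm of [A *m B] by [c ^+ 2 / 4]: an eigenvector [v] for a nonzero eigenvalue
    [s ^+ 2], together with [u = A B v / s], is a pair of singular vectors as in
    [singular_value_le]. *)
Lemma mulmx_sqr_le n (A B : 'M[C]_n) (c : R) :
  psdmx A -> psdmx B -> 0 < c -> loewner_le (A + B) (c%:C)%:M ->
  loewner_le (B *m (A *m A) *m B) (((c ^+ 2 / 4) ^+ 2)%:C)%:M.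
Proof.
move=> pA pB c0 ABc.
have p0 : psdmx (B *m (A *m A) *m B).
  have p1 : psdmx (1%:M : 'M[C]_n).
    apply: psdmxP => [|v]; first by apply/hermP; exact: adjmx1.
    by rewrite mul1mx dot_ge0.
  have := psd_conj B (psd_conj A p1).
  by rewrite mulmx1 (hermP _ (proj1 pA)) (hermP _ (proj1 pB)).
have [P Pu [d dE d0]] := psd_udiagP p0.
rewrite dE -(udiag_const Pu); apply/(loewner_udiag Pu) => i.
have q0 : 0 <= c ^+ 2 / 4 by rewrite divr_ge0// sqr_ge0.
have [-> |di0] := eqVneq (d i) 0; first exact: sqr_ge0.
have s0 : 0 < Num.sqrt (d i) by rewrite sqrtr_gt0 lt_def di0 d0.
rewrite -(sqr_sqrtr (d0 i)) ler_sqr ?nnegrE ?(ltW s0)//.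
pose v : 'cV[C]_n := P ^t* *m delta_mx i 0.
have sC0 : (Num.sqrt (d i))%:C != 0 :> C by rewrite fmorph_eq0 gt_eqF.
apply: (singular_value_le (u := (Num.sqrt (d i))%:C^-1 *: (A *m (B *m v)))
  (v := v) pA pB c0 s0 ABc) => //.
- exact: unitary_col_neq0.
- by rewrite scalerA divff// scale1r.
- have M0 (w : 'cV_n) : B *m (A *m (A *m (B *m w))) = udiag P d *m w by rewrite -dE !mulmxA.
  rewrite -!scalemxAr. rewrite M0.
  rewrite udiag_eigen// -/v scalerA.
  by rewrite -{2}(sqr_sqrtr (d0 i)) rmorphXn /= expr2 mulKf.
Qed.

(** * Real powers of matrices with a bounded sum *)

Lemma powmx_udiag n (P : 'M[C]_n) d (p : R) : P \is unitarymx ->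
  powmx p (udiag P d) = udiag P (fun i => d i `^ p).
Proof. exact: mxfun_udiag. Qed.

Lemma powR_le_linear (c t r : R) : 0 <= t <= c -> 1 <= r ->
  t `^ r <= c `^ (r - 1) * t.
Proof.
move=> /andP[t0 tc] r1; have r0 : 0 < r := lt_le_trans ltr01 r1.
rewrite -(mulr_powRB1 t0 r0) mulrC; apply: ler_wpM2r => //.
by apply: ge0_ler_powR => //; rewrite ?subr_ge0// nnegrE (le_trans t0).
Qed.

Lemma powmx_le_linear n (A : 'M[C]_n) (c r : R) : psdmx A -> 1 <= r ->
  loewner_le A (c%:C)%:M -> loewner_le (powmx r A) ((c `^ (r - 1))%:C *: A).
Proof.
move=> /psd_udiagP[P Pu [d -> d0]] r1.
rewrite -(udiag_const Pu) (powmx_udiag _ _ Pu) udiagZ => /(loewner_udiag Pu) dc.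
by apply/(loewner_udiag Pu) => i; apply: powR_le_linear; rewrite ?d0 ?dc.
Qed.

(** [A] and [B] may fail to commute, so each power is first replaced by its linear bound,
    [c^(r - 1)] times the matrix; the hypothesis on [A + B] then applies. *)
Lemma powmx_add_le n (A B : 'M[C]_n) (c r : R) :
  psdmx A -> psdmx B -> 0 < c -> 1 <= r -> loewner_le (A + B) (c%:C)%:M ->
  loewner_le (powmx r A + powmx r B) ((c `^ r)%:C)%:M.
Proof.
move=> pA pB c0 r1 ABc.
have Bc := loewner_addr pA ABc.
have Ac := loewner_addl pB ABc.
apply: (loewner_trans (loewnerD (powmx_le_linear pA r1 Ac) (powmx_le_linear pB r1 Bc))).
rewrite -scalerDr.
have := loewnerZ (powR_ge0 c (r - 1)) ABc.
by rewrite scale_scalar_mx -rmorphM /= mulrC mulr_powRB1// ?ltW// (lt_le_trans ltr01).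
Qed.

Lemma powmx_psd n (A : 'M[C]_n) (p : R) : psdmx A -> psdmx (powmx p A).
Proof.
move=> /psd_udiagP[P Pu [d -> d0]]; rewrite powmx_udiag//.
by apply/(psd_udiag Pu) => i; exact: powR_ge0.
Qed.

Lemma powmx_sqr n (A : 'M[C]_n) (r : R) : posdefmx A ->
  powmx r A *m powmx r A = powmx (r * 2) A.
Proof.
move=> /posdef_udiagP[P Pu [d -> d0]]; rewrite !(powmx_udiag _ _ Pu) (udiagM Pu).
apply: eq_udiag => i; rewrite -powRD ?(gt_eqF (d0 i)) ?implybT//.
by rewrite mulr_natr mulr2n.
Qed.

(** With [Y = k G^-1], [powmx_add_le] and [mulmx_sqr_le] give [Y^r F^(2 r) Y^r <= (c^(2 r) / 4)^2].
    Conjugation by [Y^-r] isolates [F^(2 r)] and leaves [Y^(-2 r) = k^(-2 r) G^(2 r)] on the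
    right. *)
Lemma powmx_le_of_add_inv n (F G : 'M[C]_n) (k c r : R) :
  posdefmx F -> posdefmx G -> 0 < k -> 0 < c -> 1 <= r ->
  loewner_le (F + k%:C *: invmx G) (c%:C)%:M ->
  loewner_le (powmx (r * 2) F)
    (((c `^ (r * 2) / (4 * k `^ r)) ^+ 2)%:C *: powmx (r * 2) G).
Proof.
move=> pF pG k0 c0 r1; have [Q Qu [e GE e0]] := posdef_udiagP pG.
have pY : psdmx (k%:C *: invmx G).
  by apply: psdZ; [exact: ltW | exact/posdef_psd/posdef_inv].
move=> /(powmx_add_le (posdef_psd pF) pY c0 r1).
have YE : powmx r (k%:C *: invmx G) = udiag Q (fun i => (k / e i) `^ r).
  have en0 i : e i != 0 by rewrite gt_eqF.
  by rewrite GE (invmx_udiag Qu en0) udiagZ (powmx_udiag _ _ Qu).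
move=> /(mulmx_sqr_le (powmx_psd r (posdef_psd pF)) (powmx_psd r pY) (powR_gt0 r c0)).
pose Z := udiag Q (fun i => (e i / k) `^ r).
move=> /(loewner_conj Z); rewrite (hermP _ (udiag_herm _ _)) YE.
have YZ : udiag Q (fun i => (k / e i) `^ r) *m Z = 1%:M.
  rewrite (udiagM Qu) -[RHS](udiag_const Qu 1).
  apply: eq_udiag => i; rewrite -powRM ?divr_ge0// ?ltW//.
  by rewrite mulrA divfK ?gt_eqF// divff ?powR1// gt_eqF.
rewrite (mulmx_unsandwich _ YZ) (powmx_sqr _ pF).
rewrite mul_mx_scalar -scalemxAl (udiagM Qu) (udiagZ Q) GE (powmx_udiag _ _ Qu) (udiagZ Q).
have key x : 0 < x -> ((c `^ r) ^+ 2 / 4) ^+ 2 * ((x / k) `^ r * (x / k) `^ r) =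
    (c `^ (r * 2) / (4 * k `^ r)) ^+ 2 * x `^ (r * 2).
  move=> x0; rewrite powRM ?invr_ge0 ?(ltW x0) ?(ltW k0)//.
  rewrite -(powR_inv1 (ltW k0)) -powRrM mulN1r powRN.
  rewrite !powRrM !powR_mulrn ?powR_ge0//.
  by field; rewrite gt_eqF ?powR_gt0.
by rewrite (eq_udiag Q (fun i => key _ (e0 i))).
Qed.

End NormOfProduct.

(** * Scalar bounds for operator monotone functions *)

(** The expansion [g (1 + h L) = h L + o(h)] as [h] decreases to 0; the free slope [L] covers both
    sides of 1. *)
Lemma is_derive1_near (R : realType) (g : R -> R) (L e : R) :
  is_derive (1 : R) (1 : R) g 1 -> g 1 = 0 -> 0 < e ->
  exists2 r : R, 0 < r &
    forall h, 0 < h < r -> `|g (1 + h * L) - h * L| <= e * h.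
Proof.
(* For [L = 0] the increment [h * L] vanishes and the difference quotient gives nothing; [g 1 = 0]
   settles this case. *)
move=> [dg g1] g0 e0; have [->|L0] := eqVneq L 0.
  exists 1 => // h /andP[h0 _].
  by rewrite mulr0 addr0 g0 subrr normr0 mulr_ge0// ltW.
have := dg; rewrite /derivable => /cvgrPdist_le.
rewrite -/(derive g 1 1) g1 => hd.
have eL : 0 < e / `|L| by rewrite divr_gt0 ?normr_gt0.
have [r /= r0 hr] := hd _ eL; exists (r / `|L|); first by rewrite divr_gt0 ?normr_gt0.
move=> h /andP[h0]; rewrite ltr_pdivlMr ?normr_gt0// => hL.
have hLn0 : h * L != 0 := (mulf_neq0 (lt0r_neq0 h0) L0).
have := hr (h * L); rewrite /= sub0r normrN normrM (gtr0_norm h0).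
move=> /(_ hL hLn0).
have -> : 1 - (h * L)^-1 *: (g ((h * L)%:A + 1) - g 1) =
    1 - (h * L)^-1 * g (1 + h * L).
  by rewrite g0 subr0 (addrC _ 1) /GRing.scale /= mulr1.
have -> : g (1 + h * L) - h * L = - (h * L * (1 - (h * L)^-1 * g (1 + h * L))).
  by rewrite mulrBr mulr1 mulVKf// opprB.
move=> /(ler_wpM2l (normr_ge0 (h * L))); rewrite -normrM => hn.
rewrite normrN; apply: le_trans hn _.
by rewrite normrM (gtr0_norm h0) -mulrA (mulrC `|L|) divfK ?normr_eq0// mulrC.
Qed.

Section Tangent.
Variables (R : realType) (g : R -> R).
Hypotheses (dg : is_derive (1 : R) (1 : R) g 1) (g1 : g 1 = 0).

Lemma is_derive1_small (L e : R) : 0 < e -> exists2 h : R, 0 < h < 1 &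
  0 < 1 + h * L /\ `|g (1 + h * L) - h * L| <= e * h.
Proof.
move=> e0; have [r r0 hr] := is_derive1_near L dg g1 e0.
have L1 : 0 < 1 + `|L| by rewrite ltr_pwDl.
(* The three bounds on [h] serve the expansion, [h < 1], and the positivity of [1 + h * L]. *)
have m0 : 0 < Num.min (Num.min r 1) ((1 + `|L|)^-1).
  by rewrite !lt_min r0 ltr01 invr_gt0 L1.
have [h h0 hm] : exists2 h, 0 < h & h < Num.min (Num.min r 1) ((1 + `|L|)^-1).
  by exists (Num.min (Num.min r 1) ((1 + `|L|)^-1) / 2); lra.
move: hm; rewrite !lt_min => /andP[/andP[hr' h1] hL].
exists h; first by rewrite h0.
split; last by apply: hr; rewrite h0.
have hL1 : h * (1 + `|L|) < 1 by rewrite -ltr_pdivlMr// div1r.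
have hN : - (h * `|L|) <= h * L by rewrite -mulrN ler_pM2l// lerNnormlW.
by move: hL1; rewrite mulrDr mulr1; lra.
Qed.

(** Since [g] has slope 1 at 1, [h x <= g (1 + h L) <= h (L + e)] for some small [h]; division by
    [h] leaves [x <= L + e]. *)
Lemma is_derive1_ge (L x : R) :
  (forall h, 0 < h < 1 -> 0 < 1 + h * L -> h * x <= g (1 + h * L)) -> x <= L.
Proof.
move=> hx; apply/ler_addgt0Pr => e /(is_derive1_small L)[h h01 [pos]].
rewrite ler_norml => /andP[_ hg]; have hgx := hx h h01 pos.
have /andP[h0 _] := h01; suff: h * x <= h * (L + e) by rewrite ler_pM2l.
by rewrite mulrDr; lra.
Qed.

Lemma is_derive1_le (L x : R) :
  (forall h, 0 < h < 1 -> 0 < 1 + h * L -> g (1 + h * L) <= h * x) -> L <= x.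
Proof.
move=> hx; apply/ler_addgt0Pr => e /(is_derive1_small L)[h h01 [pos]].
rewrite ler_norml => /andP[hg _]; have hgx := hx h h01 pos.
have /andP[h0 _] := h01; suff: h * L <= h * (x + e) by rewrite ler_pM2l.
by rewrite mulrDr; lra.
Qed.
End Tangent.

(** * Scalar bounds from rotated two-by-two matrices *)

Section TangentBounds.
Context {R : realType}.
Local Notation C := R[i].

Definition rot (c s : R) : 'M[C]_2 :=
  \matrix_(i, j) (if i == j then c else if i == 0 then - s else s)%:C.

Lemma rot_unitary c s : c ^+ 2 + s ^+ 2 = 1 -> rot c s \is unitarymx.
Proof.
move=> cs; apply/unitarymxP/matrixP => i j.
rewrite !mxE !big_ord_recl big_ord0 !mxE /= !conjC_realc -!rmorphM -!rmorphD /=.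
case: i j => [[|[|]]//= ?] [[|[|]]//= ?]; rewrite /= ?mulr1n ?mulr0n.
- by rewrite addr0 mulrNN -!expr2 cs.
- by rewrite addr0 (mulrC c) mulNr addrN.
- by rewrite addr0 mulrN (mulrC c) addrN.
- by rewrite addr0 -!expr2 addrC cs.
Qed.

Definition pair_diag (a b : R) (i : 'I_2) : R := if i == 0 then a else b.

Lemma dot_udiag_rot c s a b (v : 'cV[C]_2) :
  dot v (udiag (rot c s) (pair_diag a b) *m v) =
  a%:C * `|c%:C * v 0 0 - s%:C * v 1 0| ^+ 2 +
  b%:C * `|s%:C * v 0 0 + c%:C * v 1 0| ^+ 2.
Proof.
rewrite dot_udiag !big_ord_recl big_ord0 addr0 !mxE !big_ord_recl !big_ord0 !mxE /=.
have -> : lift ord0 ord0 = 1 :> 'I_2 by exact/val_inj.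
by rewrite !addr0 rmorphN mulNr.
Qed.

(** The difference has diagonal [e], [k ^+ 2 / e] and off-diagonal entries [- k], so its determinant
    vanishes and one square remains. The sign of [e] is free, so the identity serves both
    comparisons. *)
Lemma dot_rot_diff c s a b e (v : 'cV[C]_2) : e != 0 ->
  let k := c * s * (b - a) in
  dot v (udiag (rot 1 0) (pair_diag (c ^+ 2 * a + s ^+ 2 * b + e)
      (s ^+ 2 * a + c ^+ 2 * b + k ^+ 2 / e)) *m v) -
  dot v (udiag (rot c s) (pair_diag a b) *m v) =
  (e^-1)%:C * `|e%:C * v 0 0 - k%:C * v 1 0| ^+ 2.
Proof.
move=> e0 k; rewrite !dot_udiag_rot !normCK.
have eC : e%:C != 0 :> C by rewrite fmorph_eq0.
move: (v 0 0) (v 1 0) => x y.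
rewrite !(rmorphB, rmorphD, rmorphM, rmorph0, rmorph1, fmorphV) /= !conjC_realc.
move: (Num.conj x) (Num.conj y) => x' y'.
move: (c%:C) (s%:C) (a%:C) (b%:C) (e%:C) eC => C0 S0 A0 B0 E0 eC.
by field.
Qed.

(* The corner entry of the rotated matrix is the convex combination
   [c ^+ 2 * a + s ^+ 2 * b]. Moving it by [e] while moving the other diagonal
   entry by [k ^+ 2 / e], where [k] is the off-diagonal entry, makes the
   difference of rank one, so that operator monotonicity bounds
   [c ^+ 2 * g a + s ^+ 2 * g b] by the value of [g] near that combination. *)
Lemma loewner_rot_le c s a b e : c ^+ 2 + s ^+ 2 = 1 -> 0 < e ->
  loewner_le (udiag (rot c s) (pair_diag a b))
    (udiag (rot 1 0) (pair_diag (c ^+ 2 * a + s ^+ 2 * b + e)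
      (s ^+ 2 * a + c ^+ 2 * b + (c * s * (b - a)) ^+ 2 / e))).
Proof.
move=> cs e0; apply: psdmxP => [|v]; first by apply: hermB; exact: udiag_herm.
rewrite mulmxBl dotDr dotNr dot_rot_diff ?gt_eqF// mulr_ge0 ?exprn_ge0//.
by rewrite ler0c invr_ge0 ltW.
Qed.

Lemma loewner_rot_ge c s a b e : c ^+ 2 + s ^+ 2 = 1 -> 0 < e ->
  loewner_le (udiag (rot 1 0) (pair_diag (c ^+ 2 * a + s ^+ 2 * b - e)
      (s ^+ 2 * a + c ^+ 2 * b - (c * s * (b - a)) ^+ 2 / e)))
    (udiag (rot c s) (pair_diag a b)).
Proof.
move=> cs e0; apply: psdmxP => [|v]; first by apply: hermB; exact: udiag_herm.
rewrite mulmxBl dotDr dotNr -[X in 0 <= X]opprB oppr_ge0 -mulrN -invrN.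
rewrite dot_rot_diff ?oppr_eq0 ?gt_eqF// mulr_le0_ge0 ?exprn_ge0//.
by rewrite lecR invr_le0 oppr_le0 ltW.
Qed.

Lemma dot_udiag_rot_corner c s a b :
  dot (delta_mx 0 0) (udiag (rot c s) (pair_diag a b) *m delta_mx 0 0) =
  (c ^+ 2 * a + s ^+ 2 * b)%:C.
Proof.
rewrite dot_udiag_rot !mxE /= !mulr1 !mulr0 subr0 addr0 !normCK !conjC_realc.
by rewrite -!rmorphM -rmorphD /= (mulrC a) (mulrC b) -!expr2.
Qed.

Lemma loewner_rot_corner c s a b c' s' p q :
  loewner_le (udiag (rot c s) (pair_diag a b)) (udiag (rot c' s') (pair_diag p q)) ->
  c ^+ 2 * a + s ^+ 2 * b <= c' ^+ 2 * p + s' ^+ 2 * q.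
Proof. by move=> /(loewner_dot (delta_mx 0 0)); rewrite !dot_udiag_rot_corner lecR. Qed.

Section OperatorMonotone.
Variable g : R -> R.
Hypothesis g_mono : operator_monotone g.

Lemma mono_pair c s c' s' a b p q : c ^+ 2 + s ^+ 2 = 1 -> c' ^+ 2 + s' ^+ 2 = 1 ->
  0 < a -> 0 < b -> 0 < p -> 0 < q ->
  loewner_le (udiag (rot c s) (pair_diag a b)) (udiag (rot c' s') (pair_diag p q)) ->
  loewner_le (udiag (rot c s) (pair_diag (g a) (g b)))
    (udiag (rot c' s') (pair_diag (g p) (g q))).
Proof.
move=> /rot_unitary u /rot_unitary u' a0 b0 p0 q0 /g_mono.
have gpair x y i : (g \o pair_diag x y) i = pair_diag (g x) (g y) i.
  by rewrite /= /pair_diag; case: ifP.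
rewrite !mxfun_udiag// !(eq_udiag _ (gpair _ _)); apply.
  by apply/posdef_udiag => // i; rewrite /pair_diag; case: ifP.
by apply/posdef_udiag => // i; rewrite /pair_diag; case: ifP.
Qed.

(** For the rotation with squared cosine [1 - h] and squared sine [h], the left side is a corner
    entry after applying [g]; the majorant is diagonal, so its corner is a single value of [g]. *)
Lemma mono_rot_le a b h e : 0 < a -> 0 < b -> 0 < h < 1 -> 0 < e ->
  (1 - h) * g a + h * g b <= g ((1 - h) * a + h * b + e).
Proof.
move=> a0 b0 /andP[h0 h1] e0.
have cE : Num.sqrt (1 - h) ^+ 2 = 1 - h by rewrite sqr_sqrtr ?subr_ge0 ?ltW.
have sE : Num.sqrt h ^+ 2 = h by rewrite sqr_sqrtr ?ltW.
have h1' : 0 < 1 - h by rewrite subr_gt0.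
have cs : Num.sqrt (1 - h) ^+ 2 + Num.sqrt h ^+ 2 = 1 by rewrite cE sE subrK.
have cs0 : 1 ^+ 2 + 0 ^+ 2 = 1 :> R by rewrite expr1n expr0n addr0.
have p0 : 0 < (1 - h) * a + h * b + e by rewrite !addr_gt0 ?mulr_gt0.
have k0 : 0 <= (Num.sqrt (1 - h) * Num.sqrt h * (b - a)) ^+ 2 / e.
  by rewrite divr_ge0 ?sqr_ge0 ?(ltW e0).
have q0 : 0 < h * a + (1 - h) * b + (Num.sqrt (1 - h) * Num.sqrt h * (b - a)) ^+ 2 / e.
  by apply: ltr_wpDr => //; rewrite addr_gt0 ?mulr_gt0.
have := loewner_rot_le a b cs e0; rewrite cE sE.
move=> /(mono_pair cs cs0 a0 b0 p0 q0) /loewner_rot_corner.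
by rewrite cE sE expr1n mul1r expr0n mul0r addr0.
Qed.

(** The diagonal minorant may lose positivity; the last two hypotheses say that its two entries are
    positive. *)
Lemma mono_rot_ge a b h e : 0 < a -> 0 < b -> 0 < h < 1 -> 0 < e ->
  0 < (1 - h) * a + h * b - e ->
  (1 - h) * h * (b - a) ^+ 2 / e < h * a + (1 - h) * b ->
  g ((1 - h) * a + h * b - e) <= (1 - h) * g a + h * g b.
Proof.
move=> a0 b0 /andP[h0 h1] e0 p0 q0.
have cE : Num.sqrt (1 - h) ^+ 2 = 1 - h by rewrite sqr_sqrtr ?subr_ge0 ?ltW.
have sE : Num.sqrt h ^+ 2 = h by rewrite sqr_sqrtr ?ltW.
have cs : Num.sqrt (1 - h) ^+ 2 + Num.sqrt h ^+ 2 = 1 by rewrite cE sE subrK.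
have cs0 : 1 ^+ 2 + 0 ^+ 2 = 1 :> R by rewrite expr1n expr0n addr0.
have := loewner_rot_ge a b cs e0.
rewrite -subr_gt0 in q0; rewrite !exprMn cE sE.
move=> /(mono_pair cs0 cs p0 q0 a0 b0) /loewner_rot_corner.
by rewrite cE sE expr1n mul1r expr0n mul0r addr0.
Qed.

Hypotheses (dg : is_derive (1 : R) (1 : R) g 1) (g1 : g 1 = 0).

Lemma mono_le_subr1 t : 0 < t -> g t <= t - 1.
Proof.
move=> t0; apply/ler_addgt0Pr => e e0.
apply: (is_derive1_ge dg g1) => h h01 _; have /andP[h0 h1] := h01.
(* The shift [h * e] is proportional to [h], so the evaluation point stays on a ray from 1, of slope
   [t - 1 + e]. *)
have := mono_rot_le ltr01 t0 h01 (mulr_gt0 h0 e0).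
have -> : 1 + h * (t - 1 + e) = (1 - h) * 1 + h * t + h * e by ring.
by rewrite g1 mulr0 add0r.
Qed.

Lemma mono_ge_subr1V t : 0 < t -> 1 - t^-1 <= g t.
Proof.
move=> t0; apply/ler_addgt0Pr => e e0; rewrite -lerBlDr.
(* With shift [h * r], positivity of the second entry requires [(t - 1)^2 / r <= t] in the limit of
   small [h]. The least such [r] is [(t - 1)^2 / t], and subtracting it from [t - 1] leaves exactly
   [1 - 1 / t]. *)
pose r := (t - 1) ^+ 2 / t + e.
have r0 : 0 < r by rewrite ltr_wpDl// divr_ge0 ?sqr_ge0 ?ltW.
have -> : 1 - t^-1 - e = t - 1 - r by rewrite /r; field; rewrite gt_eqF.
apply: (is_derive1_le dg g1) => h h01 pos; have /andP[h0 h1] := h01.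
have pE : 1 + h * (t - 1 - r) = (1 - h) * 1 + h * t - h * r by ring.
have := @mono_rot_ge 1 t h (h * r) ltr01 t0 h01 (mulr_gt0 h0 r0).
rewrite -pE g1 mulr0 add0r; apply=> //.
have -> : (1 - h) * h * (t - 1) ^+ 2 / (h * r) = (1 - h) * ((t - 1) ^+ 2 / r).
  by field; rewrite !gt_eqF.
have : (t - 1) ^+ 2 / r <= t.
  by rewrite ler_pdivrMr// /r mulrDr (mulrCA t) divff ?gt_eqF// mulr1 lerDl mulr_ge0 ?ltW.
move=> /(ler_wpM2l (_ : 0 <= 1 - h)) => H; apply: le_lt_trans (H _) _.
  by rewrite subr_ge0 ltW.
by rewrite mulr1 ltrDr.
Qed.

End OperatorMonotone.

End TangentBounds.

(** * Inverses under positive unital maps *)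

Section InverseDomination.
Context {R : realType}.
Local Notation C := R[i].

(* For [A] positive definite this says [invmx A <= B]; the quadratic form makes
   the relation stable under positive unital maps and convex combinations. *)
Definition inv_dominated n (A B : 'M[C]_n) : Prop :=
  forall u v : 'cV[C]_n,
    0 <= dot u (A *m u) - (dot u v + dot v u) + dot v (B *m v).

Lemma inv_dominated_posdef n (A B : 'M[C]_n) :
  psdmx A -> inv_dominated A B -> posdefmx A.
Proof.
move=> /psd_udiagP[P Pu [d -> d0]] AB; apply/(posdef_udiag Pu) => i.
rewrite lt_def d0 andbT; apply/negP => /eqP di0.
pose v : 'cV[C]_n := P ^t* *m delta_mx i 0.
(* On a null vector [v] of [A], the form at [(t v, v)] has real part [- 2 t + Re <v, B v>], negative
   for this [t]. *)
pose t : R := `|complex.Re (dot v (B *m v))| + 1.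
have vv : dot v v = 1.
  have := dot_udiag_col Pu (fun=> 1) i.
  by rewrite (udiag_const Pu) mul_scalar_mx scale1r.
have := AB (t%:C *: v) v.
rewrite -scalemxAr (udiag_eigen Pu) di0 scale0r scaler0 dot0r.
rewrite dotZl dotZr vv mulr1 add0r lecE => /andP[_] /=.
rewrite raddfD raddfN raddfD /= -/v.
have := ler_norm (complex.Re (dot v (B *m v))); rewrite /t.
have := normr_ge0 (complex.Re (dot v (B *m v))).
lra.
Qed.

Lemma inv_dominated_invmx n (A B : 'M[C]_n) :
  posdefmx A -> B \is hermsymmx -> inv_dominated A B -> loewner_le (invmx A) B.
Proof.
move=> pA hB AB; apply: psdmxP => [|v].
  exact: (hermB hB (proj1 (posdef_inv pA))).
(* At [u = A^-1 v] the form reduces to [<v, (B - A^-1) v>]. *)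
have := AB (invmx A *m v) v; rewrite mulmxA (mulmxV (posdef_unit pA)) mul1mx.
by rewrite opprD addrA subrr add0r mulmxBl dotDr dotNr addrC.
Qed.

Lemma dot_sumr (I : Type) (r : seq I) n (u : 'cV[C]_n) (F : I -> 'cV[C]_n) :
  dot u (\sum_(i <- r) F i) = \sum_(i <- r) dot u (F i).
Proof.
elim: r => [|i r IH]; last by rewrite !big_cons dotDr IH.
by rewrite !big_nil dot0r.
Qed.

(** This carries operator convexity of the inverse: the form is affine in the pair [(A, B)], and
    weights of total 1 preserve its constant part. *)
Lemma inv_dominated_sum n k (w : 'I_n -> R) (A B : 'I_n -> 'M[C]_k) :
  weight_vector w -> (forall i, inv_dominated (A i) (B i)) ->
  inv_dominated (\sum_i (w i)%:C *: A i) (\sum_i (w i)%:C *: B i).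
Proof.
move=> [w0 w1] AB u v; rewrite !mulmx_suml !dot_sumr.
rewrite -[dot u v + dot v u]mul1r (_ : 1 = (1 : R)%:C)// -w1 rmorph_sum mulr_suml.
rewrite -sumrB -big_split /=; apply: sumr_ge0 => i _.
rewrite -!scalemxAl !dotZr -mulrBr -mulrDr.
by apply: mulr_ge0 (AB i u v); rewrite ler0c ltW.
Qed.

Lemma udiag_sum n (P : 'M[C]_n) (I : Type) (r : seq I) (f : I -> 'I_n -> R) :
  P \is unitarymx ->
  \sum_(j <- r) udiag P (f j) = udiag P (fun i => \sum_(j <- r) f j i).
Proof.
move=> Pu; elim: r => [|j r IH].
  rewrite big_nil (eq_udiag P (e := fun=> 0)) => [|i]; last by rewrite big_nil.
  by rewrite (udiag_const Pu) -scalemx1 scale0r.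
rewrite big_cons IH udiagD; apply: eq_udiag => i.
by rewrite big_cons.
Qed.

Lemma udiag_spectral_sum n (P : 'M[C]_n) (d : 'I_n -> R) : P \is unitarymx ->
  udiag P d = \sum_j (d j)%:C *: udiag P (fun i => (i == j)%:R).
Proof.
move=> Pu; under eq_bigr => j _ do rewrite udiagZ.
rewrite (udiag_sum _ _ Pu); apply: eq_udiag => i.
rewrite (bigD1 i)//= eqxx mulr1 big1 ?addr0// => j ji.
by rewrite eq_sym (negbTE ji) mulr0.
Qed.

Section PositiveUnital.
Variables (k1 k2 : nat) (Phi : {linear 'M[C]_k1 -> 'M[C]_k2}).
Hypotheses (Phi_pos : positive_map Phi) (Phi_unital : unital_map Phi).

Lemma positive_map_loewner A B : loewner_le A B -> loewner_le (Phi A) (Phi B).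
Proof. by rewrite /loewner_le -linearB; exact: Phi_pos. Qed.

Lemma unital_map_scalar (a : C) : Phi a%:M = a%:M.
Proof. by rewrite -scalemx1 linearZ /= Phi_unital scalemx1. Qed.

(* Choi's inequality, through the spectral resolution [A = \sum_j d j E j]: each
   [Phi (E j)] is positive and they sum up to the identity. *)
Lemma inv_dominated_map A : posdefmx A ->
  inv_dominated (Phi A) (Phi (invmx A)).
Proof.
move=> /posdef_udiagP[P Pu [d -> d0]] u v.
have dn0 i : d i != 0 by rewrite gt_eqF.
rewrite (invmx_udiag Pu dn0) !(udiag_spectral_sum _ Pu) !linear_sum /=.
pose Q j := Phi (udiag P (fun i => (i == j)%:R)).
have pQ j : psdmx (Q j) by apply/Phi_pos/(psd_udiag Pu) => i; case: (i == j).
have Q1 : \sum_j Q j = 1%:M.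
  rewrite -linear_sum /= (udiag_sum _ _ Pu) -Phi_unital; congr (Phi _).
  rewrite -[RHS](udiag_const Pu 1); apply: eq_udiag => i.
  rewrite (bigD1 i)//= eqxx big1 ?addr0// => j ji.
  by rewrite eq_sym (negbTE ji).
have dotQ x y : dot x y = \sum_j dot x (Q j *m y).
  by rewrite -dot_sumr -mulmx_suml Q1 mul1mx.
under eq_bigr => j _ do rewrite linearZ /= -/(Q j).
under [X in dot v (X *m v)]eq_bigr => j _ do rewrite linearZ /= -/(Q j).
rewrite !mulmx_suml !dot_sumr (dotQ u v) (dotQ v u) -big_split -sumrB -big_split /=.
apply: sumr_ge0 => j _; rewrite -!scalemxAl !dotZr.
(* The [j]-th summand equals [(d j)^-1 <d j u - v, Q j (d j u - v)>]. *)
have := psd_dot ((d j)%:C *: u - v) (pQ j).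
rewrite (dot_sub_herm _ _ _ (proj1 (pQ j))) -(dot_herm _ _ (proj1 (pQ j))) => h.
have dC : (d j)%:C != 0 :> C by rewrite fmorph_eq0.
have dV : 0 <= ((d j)^-1)%:C :> C by rewrite ler0c invr_ge0 ltW.
have := mulr_ge0 dV h; rewrite fmorphV.
move: (dot u _) (dot u _) (dot v _) (dot v _) => x y z t.
rewrite mulrDr mulrBr expr2 -mulrA !mulKf//.
Qed.

Lemma posdef_map A : posdefmx A -> posdefmx (Phi A).
Proof.
move=> pA; apply: inv_dominated_posdef (inv_dominated_map pA).
exact/Phi_pos/posdef_psd.
Qed.

End PositiveUnital.
End InverseDomination.

(** * The Karcher mean between the harmonic and arithmetic means *)

Section WeightedMeans.
Context {R : realType}.
Local Notation C := R[i].

Lemma loewner_weighted n k (w : 'I_n -> R) (A B : 'I_n -> 'M[C]_k) :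
  weight_vector w -> (forall i, loewner_le (A i) (B i)) ->
  loewner_le (\sum_i (w i)%:C *: A i) (\sum_i (w i)%:C *: B i).
Proof.
by move=> [w0 _] AB; apply: loewner_sum => i; apply: loewnerZ (ltW (w0 i)) (AB i).
Qed.

Lemma weighted_const n k (w : 'I_n -> R) (B : 'M[C]_k) :
  weight_vector w -> \sum_i (w i)%:C *: B = B.
Proof. by move=> [_ w1]; rewrite -scaler_suml -rmorph_sum w1 scale1r. Qed.

Lemma loewner_weighted_scalar n k (w : 'I_n -> R) (A : 'I_n -> 'M[C]_k) (a : C) :
  weight_vector w -> (forall i, loewner_le (A i) a%:M) ->
  loewner_le (\sum_i (w i)%:C *: A i) a%:M.
Proof.
by move=> ww Aa; have := loewner_weighted ww Aa; rewrite (weighted_const _ ww).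
Qed.

Section Karcher.
Variables (g : R -> R) (gL : classL g).

Lemma mxfun_le_sub1 k (B : 'M[C]_k) : posdefmx B ->
  loewner_le (mxfun g B) (B - 1%:M).
Proof.
case: gL => gm g1 dg /posdef_udiagP[P Pu [d -> d0]].
rewrite (mxfun_udiag _ _ Pu) -[1%:M](udiag_const Pu 1) udiagB.
by apply/(loewner_udiag Pu) => i; exact: mono_le_subr1.
Qed.

Lemma mxfun_ge_sub1V k (B : 'M[C]_k) : posdefmx B ->
  loewner_le (1%:M - invmx B) (mxfun g B).
Proof.
case: gL => gm g1 dg /posdef_udiagP[P Pu [d -> d0]].
have dn0 i : d i != 0 by rewrite gt_eqF.
rewrite (mxfun_udiag _ _ Pu) (invmx_udiag Pu dn0) -[1%:M](udiag_const Pu 1) udiagB.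
by apply/(loewner_udiag Pu) => i; exact: mono_ge_subr1V.
Qed.

(** [Q] is the square root of [X], the inverse of the factor in the Karcher equation; these
    identities let that factor be abstracted afterwards. *)
Lemma posdef_sqrt k (X : 'M[C]_k) : posdefmx X -> exists Q : 'M[C]_k,
  [/\ Q ^t* = Q, Q *m Q = X, (powmx (- 2^-1) X) ^t* = powmx (- 2^-1) X &
      Q *m powmx (- 2^-1) X = 1%:M].
Proof.
move=> /posdef_udiagP[P Pu [d -> d0]].
exists (udiag P (fun i => d i `^ 2^-1)); rewrite (powmx_udiag _ _ Pu).
split.
- exact/hermP/udiag_herm.
- rewrite (udiagM Pu); apply: eq_udiag => i.
  rewrite -powRD; last by rewrite (gt_eqF (d0 i)) implybT.
  by rewrite (_ : 2^-1 + 2^-1 = 1) ?powRr1 ?(ltW (d0 i))//; lra.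
- exact/hermP/udiag_herm.
- rewrite (udiagM Pu) -[RHS](udiag_const Pu 1); apply: eq_udiag => i.
  by rewrite powRN divff// gt_eqF ?powR_gt0.
Qed.

Variables (n k : nat) (w : 'I_n -> R) (A : 'I_n -> 'M[C]_k) (X : 'M[C]_k).
Hypotheses (ww : weight_vector w) (pA : forall i, posdefmx (A i)).
Hypothesis sX : is_sigma g w A X.

Lemma posdef_conj (B S Q : 'M[C]_k) : posdefmx B -> Q *m S = 1%:M ->
  posdefmx (S ^t* *m B *m S).
Proof.
move=> pB QS; apply: posdefmxP => [|v v0].
  by apply: herm_conj; case: pB.
rewrite -!mulmxA dot_adj trmxCK; apply: posdef_dot => //.
apply: contra v0 => /eqP Sv; apply/eqP.
by rewrite -[v]mul1mx -QS -mulmxA Sv mulmx0.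
Qed.

Lemma sandwich_sum (Y Z : 'M[C]_k) (D : 'I_n -> 'M[C]_k) : Y *m Z = 1%:M ->
  Z *m (\sum_i (w i)%:C *: (Y *m D i *m Y)) *m Z = \sum_i (w i)%:C *: D i.
Proof.
move=> YZ; rewrite mulmx_sumr mulmx_suml; apply: eq_bigr => i _.
by rewrite -scalemxAr -scalemxAl (mulmx_unsandwich _ YZ).
Qed.

Lemma invmx_left (Y Z : 'M[C]_k) : Y *m Z = 1%:M -> invmx Z = Y.
Proof.
by move=> YZ; have [_ u] := mulmx1_unit YZ; rewrite -[LHS]mul1mx -YZ (mulmxK u).
Qed.

(** With [S = X^(-1/2)], averaging [g B <= B - 1] over [B = S A_i S] turns the Karcher equation into
    [1 <= \sum_i w_i S A_i S]; conjugation by [X^(1/2)] finishes. *)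
Lemma sigma_le_arith : loewner_le X (\sum_i (w i)%:C *: A i).
Proof.
case: sX => pX; have [Q [hQ QQ hS QS]] := posdef_sqrt pX.
move: (powmx _ X) hS QS => S hS QS eq0.
have pB i : posdefmx (S *m A i *m S) by have := posdef_conj (pA i) QS; rewrite hS.
have := loewner_weighted ww (fun i => mxfun_le_sub1 (pB i)); rewrite eq0.
under eq_bigr => i _ do rewrite scalerBr.
rewrite sumrB (weighted_const _ ww) /loewner_le subr0 => /(loewner_conj Q).
by rewrite hQ mulmx1 QQ (sandwich_sum _ (mulmx1C QS)).
Qed.

(** The dual argument: [1 - B^-1 <= g B] gives [1 <= \sum_i w_i Q A_i^-1 Q] with [Q = X^(1/2)], and
    conjugation by [X^(-1/2)] finishes. *)
Lemma sigma_inv_le : loewner_le (invmx X) (\sum_i (w i)%:C *: invmx (A i)).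
Proof.
case: sX => pX; have [Q [hQ QQ hS QS]] := posdef_sqrt pX.
move: (powmx _ X) hS QS => S hS QS eq0.
have SQ := mulmx1C QS.
have pB i : posdefmx (S *m A i *m S) by have := posdef_conj (pA i) QS; rewrite hS.
have iB i : invmx (S *m A i *m S) = Q *m invmx (A i) *m Q.
  apply: invmx_left; rewrite -!mulmxA (mulmxA Q S) QS mul1mx.
  by rewrite (mulmxA (invmx _)) (mulVmx (posdef_unit (pA i))) mul1mx.
have iX : invmx X = S *m S.
  by apply: invmx_left; rewrite -QQ -mulmxA (mulmxA S Q) SQ mul1mx.
have := loewner_weighted ww (fun i => mxfun_ge_sub1V (pB i)); rewrite eq0.
under eq_bigr => i _ do rewrite scalerBr iB.
rewrite sumrB (weighted_const _ ww) /loewner_le sub0r opprB => /(loewner_conj S).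
by rewrite hS mulmx1 iX (sandwich_sum _ QS).
Qed.

End Karcher.
End WeightedMeans.

(** * The interpolating function *)

Section Interpolation.
Context {R : realType}.
Local Notation C := R[i].
Variables (m M : R).
Hypotheses (m0 : 0 < m) (mM : m < M).

(** The affine coordinate of [1 / t], equal to 0 at [t = m] and to 1 at [t = M]. *)
Definition interp_weight (t : R) : R := (m^-1 - M^-1)^-1 * (m^-1 - t^-1).

Definition interp (t : R) : R :=
  expR (interp_weight t * ln M + (1 - interp_weight t) * ln m).

Lemma invB_gt0 : 0 < m^-1 - M^-1.
Proof. by rewrite subr_gt0 ltf_pV2// posrE ?(lt_trans m0). Qed.

Lemma interp_weightC t :
  (m^-1 - M^-1)^-1 * (t^-1 - M^-1) = 1 - interp_weight t.
Proof.
rewrite /interp_weight; have E := mulVf (lt0r_neq0 invB_gt0).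
by rewrite -{}E; ring.
Qed.

Lemma interp_weight_itv t : m <= t <= M -> 0 <= interp_weight t <= 1.
Proof.
move=> /andP[mt tM]; have t0 := lt_le_trans m0 mt.
apply/andP; split.
  by rewrite mulr_ge0 ?invr_ge0 ?(ltW invB_gt0)// subr_ge0 lef_pV2.
rewrite -subr_ge0 -interp_weightC mulr_ge0 ?invr_ge0 ?(ltW invB_gt0)//.
by rewrite subr_ge0 lef_pV2 ?posrE// (lt_trans m0).
Qed.

(** The tangent line at the combined point lies below [expR], and averaging its values at [x] and
    [y] cancels the linear terms. *)
Lemma expR_convex (x y l : R) : 0 <= l <= 1 ->
  expR (l * x + (1 - l) * y) <= l * expR x + (1 - l) * expR y.
Proof.
move=> /andP[l0 l1].
have tangent (z a : R) : expR z * (1 + (a - z)) <= expR a.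
  have {2}-> : a = z + (a - z) by rewrite addrC subrK.
  by rewrite expRD ler_pM2l ?expR_gt0// expR_ge1Dx.
set z := l * x + (1 - l) * y; have hx := ler_wpM2l l0 (tangent z x).
have := ler_wpM2l (_ : 0 <= 1 - l) (tangent z y); rewrite subr_ge0 => /(_ l1) hy.
apply: le_trans (lerD hx hy); rewrite le_eqVlt; apply/orP; left; apply/eqP.
by rewrite /z; ring.
Qed.

Lemma interp_weightE t : 0 < t ->
  m * M / t = interp_weight t * m + (1 - interp_weight t) * M.
Proof.
move=> t0; have M0 := lt_trans m0 mM; have := lt0r_neq0 invB_gt0.
rewrite /interp_weight => d0.
have -> : m^-1 - M^-1 = (M - m) / (m * M) by field; rewrite !gt_eqF.
by field; rewrite !gt_eqF ?subr_gt0.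
Qed.

(** With [l] the weight, [interp t <= l M + (1 - l) m], while [m M / t = l m + (1 - l) M]; these add
    up to [m + M]. *)
Lemma interp_addV_le t : m <= t <= M -> interp t + m * M * t^-1 <= m + M.
Proof.
move=> tmM; have [/andP[mt tM] M0] := (tmM, lt_trans m0 mM).
have := expR_convex (ln M) (ln m) (interp_weight_itv tmM).
rewrite !lnK ?posrE// -/(interp t) (interp_weightE (lt_le_trans m0 mt)).
move: (interp t) (interp_weight t) => x l h; lra.
Qed.

Lemma addV_interp_le t : m <= t <= M -> t + m * M * (interp t)^-1 <= m + M.
Proof.
move=> tmM; have [/andP[mt tM] M0] := (tmM, lt_trans m0 mM).
have t0 := lt_le_trans m0 mt.
(* [m M / interp t] is the geometric mean with the endpoints exchanged, so its chord is
   [m M / t]. *)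
have h1 : m * M * (interp t)^-1 <= m * M * t^-1.
  rewrite (interp_weightE t0).
  have := expR_convex (ln m) (ln M) (interp_weight_itv tmM).
  rewrite !lnK ?posrE//; apply: le_trans; rewrite le_eqVlt; apply/orP; left.
  rewrite -{1}(lnK (_ : m \is Num.pos)) ?posrE// -{1}(lnK (_ : M \is Num.pos)) ?posrE//.
  by apply/eqP; rewrite /interp -expRN -!expRD; congr expR; ring.
have h2 : t + m * M * t^-1 <= m + M.
  rewrite -(ler_pM2r t0) mulrDl mulfVK ?gt_eqF//.
  have : 0 <= (t - m) * (M - t) by rewrite mulr_ge0 ?subr_ge0.
  lra.
lra.
Qed.

Lemma interp_term_udiag k (P : 'M[C]_k) (d : 'I_k -> R) : P \is unitarymx ->
  (forall i, 0 < d i) -> interp_term m M (udiag P d) = udiag P (interp \o d).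
Proof.
move=> Pu d0; have dn0 i : d i != 0 by rewrite gt_eqF.
rewrite /interp_term (invmx_udiag Pu dn0) -!(udiag_const Pu) !udiagB !udiagZ.
rewrite /cpowmx !udiagZ !(mxfun_udiag _ _ Pu) (udiagM Pu).
apply: eq_udiag => i /=; rewrite -expRD /interp -interp_weightC.
by congr expR; rewrite /interp_weight; ring.
Qed.

Lemma loewner_scalar_spectrum k (A : 'M[C]_k) : posdefmx A ->
  loewner_le (m%:C)%:M A -> loewner_le A (M%:C)%:M ->
  exists2 P : 'M[C]_k, P \is unitarymx &
    exists2 d, A = udiag P d & forall i, m <= d i <= M.
Proof.
move=> /posdef_udiagP[P Pu [d -> d0]]; rewrite -!(udiag_const Pu).
move=> /(loewner_udiag Pu) md /(loewner_udiag Pu) dM.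
by exists P => //; exists d => // i; rewrite md dM.
Qed.

Section Matrix.
Variables (k : nat) (A : 'M[C]_k).
Hypotheses (pA : posdefmx A).
Hypotheses (mA : loewner_le (m%:C)%:M A) (AM : loewner_le A (M%:C)%:M).

Lemma interp_term_posdef : posdefmx (interp_term m M A).
Proof.
have [P Pu [d -> dmM]] := loewner_scalar_spectrum pA mA AM.
have d0 i : 0 < d i by have /andP[/(lt_le_trans m0)] := dmM i.
by rewrite (interp_term_udiag Pu d0); apply/(posdef_udiag Pu) => i; exact: expR_gt0.
Qed.

Lemma interp_term_addV_le :
  loewner_le (interp_term m M A + (m * M)%:C *: invmx A) ((m + M)%:C)%:M.
Proof.
have [P Pu [d -> dmM]] := loewner_scalar_spectrum pA mA AM.
have d0 i : 0 < d i by have /andP[/(lt_le_trans m0)] := dmM i.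
have dn0 i : d i != 0 by rewrite gt_eqF.
rewrite (interp_term_udiag Pu d0) (invmx_udiag Pu dn0) udiagZ udiagD.
rewrite -(udiag_const Pu); apply/(loewner_udiag Pu) => i.
exact: interp_addV_le.
Qed.

Lemma addV_interp_term_le :
  loewner_le (A + (m * M)%:C *: invmx (interp_term m M A)) ((m + M)%:C)%:M.
Proof.
have [P Pu [d -> dmM]] := loewner_scalar_spectrum pA mA AM.
have d0 i : 0 < d i by have /andP[/(lt_le_trans m0)] := dmM i.
have dn0 i : (interp \o d) i != 0 by rewrite gt_eqF ?expR_gt0.
rewrite (interp_term_udiag Pu d0) (invmx_udiag Pu dn0) udiagZ udiagD.
rewrite -(udiag_const Pu); apply/(loewner_udiag Pu) => i.
exact: addV_interp_le.
Qed.

End Matrix.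

(** Both sides equal [(m + M)^(2 p) / (16 (m M)^p)]; the right one is the constant of
    [powmx_le_of_add_inv] for [r = p / 2]. *)
Lemma powR_constE (p : R) : 2 <= p ->
  ((m + M) ^+ 2 / (4 `^ (2 / p) * M * m)) `^ p =
  ((m + M) `^ (p / 2 * 2) / (4 * (m * M) `^ (p / 2))) ^+ 2.
Proof.
move=> p2; have M0 := lt_trans m0 mM; have p0 : p != 0 by rewrite gt_eqF; lra.
have c0 : 0 <= m + M by rewrite addr_ge0 ?ltW.
have k0 : 0 <= m * M by rewrite mulr_ge0 ?ltW.
have q0 : 0 <= 4 `^ (2 / p) :> R := powR_ge0 _ _.
have divE (x y : R) : 0 <= x -> 0 <= y -> (x / y) `^ p = x `^ p / y `^ p.
  by move=> x0 y0; rewrite powRM ?invr_ge0// -(powR_inv1 y0) -powRrM mulN1r powRN.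
have sqrE (x r : R) : (x `^ r) ^+ 2 = x `^ (r * 2).
  by rewrite powRrM (powR_mulrn 2) ?powR_ge0.
rewrite divfK// expr_div_n exprMn !sqrE divfK//.
rewrite -mulrA (mulrC M) (divE _ _ (sqr_ge0 _) (mulr_ge0 q0 k0)) (powRM _ q0 k0).
rewrite -powRrM divfK// (powR_mulrn 2)// -(powR_mulrn 2 c0) -powRrM.
by rewrite (mulrC p).
Qed.

End Interpolation.

(** * Transfer of the bounds through the unital positive map *)

Theorem theorem3p2 (R : realType) (g : R -> R) (n k1 k2 : nat)
    (k1_gt0 : (0 < k1)%N) (k2_gt0 : (0 < k2)%N)
    (A : 'I_n -> 'M[R[i]]_k1) (m M : R) (w : 'I_n -> R)
    (Phi : {linear 'M[R[i]]_k1 -> 'M[R[i]]_k2})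
    (sigma : 'M[R[i]]_k1) (p : R) :
  classL g ->
  (forall i, posdefmx (A i)) ->
  0 < m -> m < M ->
  (forall i, loewner_le (m%:C)%:M (A i) /\ loewner_le (A i) (M%:C)%:M) ->
  weight_vector w ->
  positive_map Phi -> unital_map Phi ->
  is_sigma g w A sigma ->
  2 <= p ->
  loewner_le
    (powmx p (Phi (interp_sum m M w A)))
    ((((m + M) ^+ 2 / (4 `^ (2 / p) * M * m)) `^ p)%:C
       *: powmx p (Phi sigma)) /\
  loewner_le
    (powmx p (Phi sigma))
    ((((m + M) ^+ 2 / (4 `^ (2 / p) * M * m)) `^ p)%:C
       *: powmx p (Phi (interp_sum m M w A))).
Proof.
move=> gL pA m0 mM AmM ww Phi_pos Phi_unital sX p2.
have M0 := lt_trans m0 mM.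
have c0 : 0 < m + M by rewrite addr_gt0.
have k0 : 0 < m * M by rewrite mulr_gt0.
have r1 : 1 <= p / 2 by rewrite ler_pdivlMr// mul1r.
have pE : p / 2 * 2 = p by rewrite divfK.
have mA i := proj1 (AmM i); have AM i := proj2 (AmM i).
have pT i : posdefmx (interp_term m M (A i)).
  exact: (interp_term_posdef m0 mM (pA i) (mA i) (AM i)).
have pG : posdefmx (Phi sigma) by apply: posdef_map (proj1 sX).
have PhiW (X : 'I_n -> 'M[R[i]]_k1) :
    Phi (\sum_i (w i)%:C *: X i) = \sum_i (w i)%:C *: Phi (X i).
  by rewrite linear_sum; apply: eq_bigr => i _; rewrite linearZ.
(* Choi's inequality is used termwise and then averaged, so the dominating matrix averages the
   inverses of the terms; it also yields invertibility in [pF]. *)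
have HV : inv_dominated (Phi (interp_sum m M w A))
    (Phi (\sum_i (w i)%:C *: invmx (interp_term m M (A i)))).
  rewrite !PhiW; apply: (inv_dominated_sum ww) => i.
  exact: inv_dominated_map.
have psdT : psdmx (interp_sum m M w A).
  by apply: psd_sum => i; apply: psdZ (posdef_psd (pT i)); exact/ltW/(proj1 ww).
have pF : posdefmx (Phi (interp_sum m M w A)).
  exact: inv_dominated_posdef (Phi_pos _ psdT) HV.
have hV : Phi (\sum_i (w i)%:C *: invmx (interp_term m M (A i))) \is hermsymmx.
  suff /Phi_pos[] : psdmx (\sum_i (w i)%:C *: invmx (interp_term m M (A i))) by [].
  by apply: psd_sum => i; apply: psdZ (posdef_psd (posdef_inv (pT i))); exact/ltW/(proj1 ww).
have FV := inv_dominated_invmx pF hV HV.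
have GV : loewner_le (invmx (Phi sigma)) (Phi (invmx sigma)).
  apply: (inv_dominated_invmx pG _ (inv_dominated_map Phi_pos Phi_unital (proj1 sX))).
  by case: (Phi_pos _ (posdef_psd (posdef_inv (proj1 sX)))).
rewrite (powR_constE m0 mM p2) pE.
(* Termwise bounds by a scalar survive averaging, as the weights sum to 1, and [Phi], as it is
   unital. *)
have weighted_pencil (X Y : 'I_n -> 'M[R[i]]_k1) :
    (forall i, loewner_le (X i + (m * M)%:C *: Y i) ((m + M)%:C)%:M) ->
    loewner_le (Phi (\sum_i (w i)%:C *: X i) +
      (m * M)%:C *: Phi (\sum_i (w i)%:C *: Y i)) ((m + M)%:C)%:M.
  move=> XY; rewrite -linearZ -linearD /= -[X in loewner_le _ X](unital_map_scalar Phi_unital).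
  apply: (positive_map_loewner Phi_pos).
  rewrite (_ : _ + _ = \sum_i (w i)%:C *: (X i + (m * M)%:C *: Y i)).
    exact: (loewner_weighted_scalar ww XY).
  rewrite scaler_sumr -big_split; apply: eq_bigr => i _ /=.
  by rewrite scalerDr !scalerA mulrC.
have FG := powmx_le_of_add_inv pF pG k0 c0 r1.
have GF := powmx_le_of_add_inv pG pF k0 c0 r1.
rewrite pE in FG GF; split; [apply: FG | apply: GF].
(* Here [G^-1 <= Phi (sigma^-1)], and the harmonic bound replaces [sigma^-1] by the average of the
   [A_i^-1]. *)
- apply: loewner_trans (weighted_pencil _ _
    (fun i => interp_term_addV_le m0 mM (pA i) (mA i) (AM i))).
  apply: loewnerD; first exact: loewner_refl.
  apply: loewnerZ (ltW k0) _; apply: loewner_trans GV _.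
  exact/(positive_map_loewner Phi_pos)/(sigma_inv_le gL ww pA sX).
(* Here the arithmetic bound controls [G], and [FV] controls [F^-1]. *)
- apply: loewner_trans (weighted_pencil _ _
    (fun i => addV_interp_term_le m0 mM (pA i) (mA i) (AM i))).
  apply: loewnerD; last exact: (loewnerZ (ltW k0) FV).
  exact/(positive_map_loewner Phi_pos)/(sigma_le_arith gL ww pA sX).
Qed.
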